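(* For all $x\ge0$, the second derivative of $Q$ satisfies $$0\le Q''(x)\le\frac{(Q'(x))^2}{Q(x)} .$$
   Context: $Q(x)=\frac{1}{\sqrt{2\pi}}\int_x^\infty e^{-t^2/2}\,dt$. *)

(* Defs.v *)
From Stdlib Require Import Reals.
From Coquelicot Require Import Coquelicot.
Open Scope R_scope.

Definition gaussQ (x : R) : R :=
  / sqrt (2 * PI) *
  RInt_gen (fun t : R => exp (- t ^ 2 / 2)) (at_point x) (Rbar_locally p_infty).

(** [Derive] and [Derive_n] are total, with arbitrary values where the limit
    does not exist. [ex_derive_n f 2 x] only says that [Derive f] is
    differentiable at [x], hence the additional requirement around [x]. *)
Definition twice_differentiable_at (f : R -> R) (x : R) : Prop :=
  locally x (fun y => ex_derive f y) /\ ex_derive_n f 2 x.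

(* Main.v *)
(** Writing [f t = exp (- t^2 / 2)], we have [Q = c (L - F)] with [F] the
    primitive of [f] and [L] its limit at infinity, so [Q' = - c f] and
    [Q'' x = c x f x]. The upper bound becomes the Mills-ratio inequality
    [x (L - F x) <= f x], which follows from [x f t <= t f t = - f' t] for
    [x <= t]; its finite version at [x = 1] also shows that [F] is bounded. *)

Require Import Defs.
From Stdlib Require Import Reals Lra.
From Coquelicot Require Import Coquelicot.
Open Scope R_scope.

Definition gauss (t : R) : R := exp (- t ^ 2 / 2).

Definition gauss_prim (y : R) : R := RInt gauss 0 y.

Lemma gauss_pos (t : R) : 0 < gauss t.
Proof. apply exp_pos. Qed.

Lemma is_derive_gauss (t : R) : is_derive gauss t (- (t * gauss t)).
Proof.
unfold gauss; auto_derive; [exact I|].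
(* The exponent is refolded so that [field] sees the same [exp] term on both sides. *)
change (- (t * (t * 1)) * / 2) with (- t ^ 2 / 2); field.
Qed.

Lemma continuous_gauss (t : R) : continuous gauss t.
Proof.
apply (ex_derive_continuous gauss); eexists; apply is_derive_gauss.
Qed.

Lemma ex_RInt_gauss (a b : R) : ex_RInt gauss a b.
Proof.
apply (ex_RInt_continuous gauss); intros z _; apply continuous_gauss.
Qed.

Lemma is_derive_gauss_prim (x : R) : is_derive gauss_prim x (gauss x).
Proof.
apply (is_derive_RInt gauss gauss_prim 0 x); [|apply continuous_gauss].
apply filter_forall; intros y.
apply (RInt_correct gauss), ex_RInt_gauss.
Qed.

Lemma RInt_gauss (a b : R) : RInt gauss a b = gauss_prim b - gauss_prim a.
Proof.
unfold gauss_prim.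
pose proof (RInt_Chasles gauss 0 a b (ex_RInt_gauss _ _) (ex_RInt_gauss _ _))
  as H.
change (RInt gauss 0 a + RInt gauss a b = RInt gauss 0 b) in H; lra.
Qed.

Lemma gauss_prim_increasing (a b : R) : a < b -> gauss_prim a < gauss_prim b.
Proof.
intros ab.
assert (H : 0 < RInt gauss a b).
{ apply RInt_gt_0; [exact ab| |].
  - intros; apply gauss_pos.
  - intros; apply continuous_gauss. }
rewrite RInt_gauss in H; lra.
Qed.

(** Integrate [x * gauss t <= t * gauss t] over [[x, y]]: the right side has primitive [- gauss], so
    its integral is [gauss x - gauss y], which is less than [gauss x]. *)
Lemma mills_bound (x y : R) :
  x <= y -> x * (gauss_prim y - gauss_prim x) <= gauss x.
Proof.
intros xy.
assert (H : is_RInt (fun t => t * gauss t) x y (minus (- gauss y) (- gauss x))).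
{ apply (is_RInt_derive (fun t => - gauss t)).
  - intros t _.
    replace (t * gauss t) with (opp (- (t * gauss t)))
      by (unfold opp; simpl; ring).
    apply (is_derive_opp gauss), is_derive_gauss.
  - intros t _.
    apply (continuous_mult (fun t : R => t) gauss);
      [apply continuous_id | apply continuous_gauss]. }
assert (H' : is_RInt (fun t => x * gauss t) x y
               (x * (gauss_prim y - gauss_prim x))).
{ rewrite <- RInt_gauss.
  apply (is_RInt_scal gauss x y x), (RInt_correct gauss), ex_RInt_gauss. }
assert (le : x * (gauss_prim y - gauss_prim x)
               <= minus (- gauss y) (- gauss x)).
{ apply (is_RInt_le _ _ _ _ _ _ xy H' H).
  intros t Ht; apply Rmult_le_compat_r; [apply Rlt_le, gauss_pos | lra]. }
unfold minus, plus, opp in le; simpl in le.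
pose proof (gauss_pos y); lra.
Qed.

(** An increasing bounded function converges at infinity to the supremum [L] of its values. *)
Lemma gauss_prim_cvg :
  exists L : R, filterlim gauss_prim (Rbar_locally p_infty) (locally L).
Proof.
destruct (completeness (fun z => exists y, z = gauss_prim y)) as [L [ub lub]].
(* Beyond 1 this bound is [mills_bound] at [x = 1], where the factor [x] disappears; before 1 it
   follows from monotonicity. *)
{ exists (gauss_prim 1 + gauss 1); intros z [y ->].
  destruct (Rle_lt_dec 1 y) as [y1 | y1].
  - pose proof (mills_bound 1 y y1); lra.
  - pose proof (gauss_prim_increasing y 1 y1); pose proof (gauss_pos 1); lra. }
{ exists (gauss_prim 0); exists 0; reflexivity. }
exists L; apply filterlim_locally; intros eps.
assert (H : exists y, L - eps < gauss_prim y).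
(* Otherwise [L - eps] would be an upper bound below the least one. *)
{ apply Classical_Prop.NNPP; intros nex.
  assert (L <= L - eps); [|destruct eps as [e he]; simpl in *; lra].
  apply lub; intros z [y ->].
  apply Rnot_lt_le; intros lt; apply nex; exists y; exact lt. }
destruct H as [M HM]; exists M; intros y My.
pose proof (gauss_prim_increasing M y My).
assert (gauss_prim y <= L) by (apply ub; exists y; reflexivity).
change (Rabs (gauss_prim y - L) < eps).
apply Rabs_def1; destruct eps as [e he]; simpl in *; lra.
Qed.

(** Passing to the limit only preserves weak inequalities, so strictness is gained on the step from
    [x] to [x + 1]. It makes [gaussQ x] positive, hence a legitimate denominator. *)
Lemma gauss_prim_lt_lim (L x : R) :
  filterlim gauss_prim (Rbar_locally p_infty) (locally L) ->
  gauss_prim x < L.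
Proof.
intros HL.
apply Rlt_le_trans with (gauss_prim (x + 1)).
{ apply gauss_prim_increasing; lra. }
apply (filterlim_le (F := Rbar_locally p_infty)
         (fun _ => gauss_prim (x + 1)) gauss_prim
         (gauss_prim (x + 1)) L); [|apply filterlim_const|exact HL].
exists (x + 1); intros y Hy; apply Rlt_le, gauss_prim_increasing, Hy.
Qed.

(** This is [mills_bound] as [y] tends to infinity. For [x > 0] it is divided by [x] first, to
    isolate [gauss_prim y]; at [x = 0] the left side vanishes. *)
Lemma mills_ratio_bound (L x : R) :
  filterlim gauss_prim (Rbar_locally p_infty) (locally L) ->
  0 <= x -> x * (L - gauss_prim x) <= gauss x.
Proof.
intros HL [x0 | <-]; [|rewrite Rmult_0_l; apply Rlt_le, gauss_pos].
assert (le : L <= gauss_prim x + gauss x / x).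
{ apply (filterlim_le (F := Rbar_locally p_infty) gauss_prim
           (fun _ => gauss_prim x + gauss x / x)
           L (gauss_prim x + gauss x / x)); [|exact HL|apply filterlim_const].
  exists x; intros y Hy.
  pose proof (mills_bound x y (Rlt_le _ _ Hy)) as H.
  rewrite Rmult_comm in H; apply Rle_div_r in H; [|exact x0].
  lra. }
replace (gauss x) with (x * (gauss x / x)) by (field; lra).
apply Rmult_le_compat_l; lra.
Qed.

Lemma gaussQ_prim (L x : R) :
  filterlim gauss_prim (Rbar_locally p_infty) (locally L) ->
  gaussQ x = / sqrt (2 * PI) * (L - gauss_prim x).
Proof.
intros HL; unfold gaussQ; f_equal.
apply is_RInt_gen_unique.
intros P HP.
assert (HD : filterlim (fun y => gauss_prim y - gauss_prim x)
               (Rbar_locally p_infty) (locally (L - gauss_prim x))).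
{ apply (filterlim_comp_2 (G := locally L) (H := locally (- gauss_prim x))
           gauss_prim (fun _ => - gauss_prim x) Rplus HL);
    [apply filterlim_const | apply (filterlim_plus L (- gauss_prim x))]. }
(* The lower endpoint is exactly [x]; the upper ones are those [y] whose integral from [x] lies in
   [P], which holds eventually by [HD]. *)
apply (Filter_prod _ _ _ (eq x) (fun y => P (gauss_prim y - gauss_prim x))).
- reflexivity.
- exact (HD P HP).
- intros ? y <- Hy; exists (gauss_prim y - gauss_prim x); split; [|exact Hy].
  rewrite <- RInt_gauss; apply (RInt_correct gauss), ex_RInt_gauss.
Qed.

Lemma is_derive_gaussQ (x : R) :
  is_derive gaussQ x (- / sqrt (2 * PI) * gauss x).
Proof.
destruct gauss_prim_cvg as [L HL].
apply is_derive_ext with (fun y => / sqrt (2 * PI) * (L - gauss_prim y)).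
{ intros y; symmetry; apply gaussQ_prim, HL. }
(* The derivative is put in the shape given by the scaling and difference rules, with [0] coming
   from the constant [L]. *)
replace (- / sqrt (2 * PI) * gauss x)
  with (/ sqrt (2 * PI) * minus 0 (gauss x))
  by (unfold minus, plus, opp; simpl; ring).
apply (is_derive_scal (fun y => L - gauss_prim y)).
apply (is_derive_minus (fun _ => L) gauss_prim);
  [apply (is_derive_const L) | apply is_derive_gauss_prim].
Qed.

Lemma is_derive_Derive_gaussQ (x : R) :
  is_derive (Derive gaussQ) x (/ sqrt (2 * PI) * (x * gauss x)).
Proof.
apply is_derive_ext with (fun y => - / sqrt (2 * PI) * gauss y).
{ intros y; symmetry; apply is_derive_unique, is_derive_gaussQ. }
replace (/ sqrt (2 * PI) * (x * gauss x))
  with (- / sqrt (2 * PI) * - (x * gauss x)) by ring.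
apply (is_derive_scal gauss), is_derive_gauss.
Qed.

Theorem lemma2 :
  forall x : R, 0 <= x ->
    twice_differentiable_at gaussQ x /\
    0 <= Derive_n gaussQ 2 x <= (Derive gaussQ x) ^ 2 / gaussQ x.
Proof.
intros x x0.
destruct gauss_prim_cvg as [L HL].
split; [split|].
- apply filter_forall; intros y; eexists; apply is_derive_gaussQ.
- eexists; apply is_derive_Derive_gaussQ.
- change (Derive_n gaussQ 2 x) with (Derive (Derive gaussQ) x).
  rewrite (is_derive_unique _ _ _ (is_derive_Derive_gaussQ x)).
  rewrite (is_derive_unique _ _ _ (is_derive_gaussQ x)).
  rewrite (gaussQ_prim L x HL).
  assert (c0 : 0 < / sqrt (2 * PI)).
  { apply Rinv_0_lt_compat, sqrt_lt_R0; pose proof PI_RGT_0; lra. }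
  set (c := / sqrt (2 * PI)) in *.
  pose proof (gauss_pos x) as g0.
  pose proof (gauss_prim_lt_lim L x HL) as lt.
  pose proof (mills_ratio_bound L x HL x0) as mills.
  split.
  + apply Rmult_le_pos; [lra|]; apply Rmult_le_pos; lra.
  (* Both sides share the nonnegative factor [c * gauss x]; what remains is
     [x <= gauss x / (L - gauss_prim x)], the Mills bound. *)
  + replace ((- c * gauss x) ^ 2 / (c * (L - gauss_prim x)))
      with (c * gauss x * (gauss x / (L - gauss_prim x))) by (field; lra).
    replace (c * (x * gauss x)) with (c * gauss x * x) by ring.
    apply Rmult_le_compat_l; [apply Rmult_le_pos; lra|].
    apply Rle_div_r; lra.
Qed.
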